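(* Assume GCH. If $X$ is a homogeneous compactum, then $\chi Nt(X)\leq c(X)$, where $c(X)$ is the cellularity of $X$.
   Context: A compactum is a compact Hausdorff space. Families of open sets are ordered by inclusion; a poset is $\kappa^{\mathrm{op}}$-like if no element is below $\kappa$-many elements. For a point $p\in X$, $\chi Nt(p,X)$ is the least $\kappa\geq\omega$ such that $p$ has a $\kappa^{\mathrm{op}}$-like local base, and $\chi Nt(X)=\sup_{p\in X}\chi Nt(p,X)$. *)

(* Defs.v *)
From HB Require Import structures.
From mathcomp Require Import all_boot all_order.
From mathcomp Require Import all_classical all_reals all_analysis.
Set Implicit Arguments. Unset Strict Implicit. Unset Printing Implicit Defensive.
Local Open Scope classical_set_scope.
Local Open Scope card_scope.

Definition card_lt T U (A : set T) (B : set U) := A #<= B /\ ~ (B #<= A).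

(* Generalized Continuum Hypothesis: for every infinite set T, every family
   S of subsets of T (a set of cardinality between |T| and 2^|T|) satisfying
   |T| <= |S| has |S| <= |T| or |S| = 2^|T|, i.e. 2^kappa = kappa^+. *)
Definition GCH : Prop :=
  forall (T : Type) (S : set (set T)), infinite_set [set: T] ->
    [set: T] #<= S -> S #<= [set: T] \/ [set: set T] #<= S.

Definition compactum (X : topologicalType) : Prop :=
  compact [set: X] /\ hausdorff_space X.

Definition homeomorphism (X : topologicalType) (f : X -> X) : Prop :=
  exists g : X -> X, [/\ continuous f, continuous g, cancel f g & cancel g f].

Definition homogeneous (X : topologicalType) : Prop :=
  forall x y : X, exists f : X -> X, homeomorphism f /\ f x = y.

Definition cellular (X : topologicalType) (F : set (set X)) : Prop :=
  (forall U, F U -> open U /\ U !=set0) /\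
  (forall U V, F U -> F V -> U <> V -> U `&` V = set0).

(* |A| < c(X), where c(X) = omega + sup { |F| : F cellular family in X }.
   Since the cardinals are well ordered, |A| < c(X) iff A is finite or
   |A| < |F| for some cellular family F. *)
Definition lt_cellularity (X : topologicalType) T (A : set T) : Prop :=
  finite_set A \/ exists F : set (set X), cellular F /\ card_lt A F.

Definition local_base (X : topologicalType) (p : X) (B : set (set X)) : Prop :=
  (forall U, B U -> open U /\ U p) /\
  (forall N, nbhs p N -> exists2 U, B U & U `<=` N).

Definition above_in (X : Type) (B : set (set X)) (U : set X) : set (set X) :=
  [set V | B V /\ U `<=` V].

(* chiNt(p, X) <= c(X): since kappa^op-likeness is monotone in kappa and
   c(X) >= omega, this holds iff p has a c(X)^op-like local base, i.e. a
   local base in which every element is below fewer than c(X) elements. *)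
Definition chiNt_le_cellularity_at (X : topologicalType) (p : X) : Prop :=
  exists B : set (set X), local_base p B /\
    forall U, B U -> lt_cellularity X (above_in B U).

Definition chiNt_le_cellularity (X : topologicalType) : Prop :=
  forall p : X, chiNt_le_cellularity_at p.

(* Main.v *)
Require Import Defs.
From mathcomp Require Import all_boot all_order.
From mathcomp Require Import all_classical all_reals all_analysis.
From mathcomp Require Import wochoice.
Set Implicit Arguments. Unset Strict Implicit. Unset Printing Implicit Defensive.
Local Open Scope classical_set_scope.
Local Open Scope card_scope.

(** Let kappa be the common character of the points of X. Thinning a minimal
    local base so that no member contains an earlier one makes it
    kappa^op-like, which settles the case kappa <= c(X). If c(X) < kappa, then
    every point has pi-character kappa: otherwise, with theta the maximum of
    c(X) and the pi-character, homogeneity and a closing-off argument give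
    |X| <= 2^theta, which is at most kappa under GCH, whereas a diagonal
    argument along nested closed sets shows that a compactum all of whose
    points have character kappa has more than kappa points. As in
    Shapirovskii's theorem on maps onto Tychonoff cubes, large pi-character
    yields, for every regular mu <= kappa, an independent family of mu pairs of
    open sets, hence a point with mu neighbourhoods such that every
    neighbourhood of the point is contained in only finitely many of them. By
    homogeneity this holds at every point; if kappa is singular, such families
    are combined along a cofinal sequence. Intersecting a family of kappa such
    neighbourhoods with a local base gives an omega^op-like local base. *)

(** * Cardinal arithmetic *)

Lemma card_le_fun T U (A : set T) (B : set U) (f : T -> U) :
  (forall x, A x -> B (f x)) ->
  (forall x y, A x -> A y -> f x = f y -> x = y) -> A #<= B.
Proof.
move=> fAB finj; have /injfunPex[g] : exists2 f : T -> U, set_fun A B f & set_inj A f.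
  exists f => [x /fAB//|x y /set_mem Ax /set_mem Ay]; exact: finj.
exact: inj_card_le.
Qed.

(** Spares building a function when the injection is known only through existential witnesses: [R]
    may be multivalued as long as the value determines the argument. *)
Lemma card_le_rel T U (A : set T) (B : set U) (R : T -> U -> Prop) :
  (forall x, A x -> exists2 y, B y & R x y) ->
  (forall x x' y, A x -> A x' -> B y -> R x y -> R x' y -> x = x') -> A #<= B.
Proof.
move=> RAB Rinj; have [->|/set0P[x0 Ax0]] := eqVneq A set0; first exact: card_ge0.
have [y0 _ _] := RAB x0 Ax0.
have /choice[f fP] x : exists y, A x -> B y /\ R x y.
  by case: (pselect (A x)) => [/RAB[y By Rxy]|nAx]; [exists y|exists y0].
apply: (card_le_fun (f := f)) => [x /fP[]//|x y Ax Ay fxy].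
have [_ Rx] := fP x Ax; have [By Ry] := fP y Ay.
by apply: Rinj Ay By _ Ry; rewrite // -fxy.
Qed.

Lemma card_le_ex T U (A : set T) (B : set U) : A #<= B -> A !=set0 ->
  exists2 f : T -> U, (forall x, A x -> B (f x)) &
    (forall x y, A x -> A y -> f x = f y -> x = y).
Proof.
move=> AB [x0 Ax0]; move: B AB; elim/Ppointed: U => U B AB.
  by move: AB; rewrite (empty_eq0 B) => /card_le0P A0; move: Ax0; rewrite A0.
have /pcard_leP[f] := AB.
exists f => [x Ax|x y Ax Ay]; first exact: funS.
by apply: inj; exact: mem_set.
Qed.

Lemma card_ge_ex T U (A : set T) (B : set U) : A #<= B -> A !=set0 ->
  exists g : U -> T, A = g @` B.
Proof.
move=> /pfcard_geP[->[]//|sj _]; exact/surjfunPex.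
Qed.

(* A maximal set of choice functions with injective evaluations must exhaust some
   [A i]. *)
Lemma card_min (I T : Type) (A : I -> set T) (i0 : I) :
  exists i, forall j, A i #<= A j.
Proof.
pose P := [set S : set (I -> T) | (forall s i, S s -> A i (s i)) /\
  (forall s s' i, S s -> S s' -> s i = s' i -> s = s')].
have [] := @Zorn_bigcup _ P.
  move=> F FP Ftot; split=> [s i [S FS Ss]|s s' i [S FS Ss] [S' FS' Ss']].
    exact: (FP _ FS).1.
  have [SS|SS] := Ftot _ _ FS FS'.
    by apply: (FP _ FS').2 => //; exact: SS.
  by apply: (FP _ FS).2 => //; exact: SS.
move=> S [[SA Sinj] Smax]; apply: contrapT => /forallNP nle.
have /choice[t tP] i : exists a, A i a /\ forall s, S s -> s i <> a.
  apply: contrapT => /forallNP noa; apply: (nle i) => j.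
  apply: (card_le_rel (R := fun a b => exists2 s, S s & s i = a /\ s j = b)).
    move=> a Aia; have /not_andP[//|/existsNP[s /not_implyP[Ss /contrapT sia]]] := noa a.
    by exists (s j); [exact: SA|exists s].
  move=> x x' y _ _ _ [s Ss [<- sj]] [s' Ss' [<- sj']].
  by rewrite (Sinj s s' j) // sj sj'.
apply: (Smax (S `|` [set t])).
  split; first exact: subsetUl.
  by move=> /(_ t) St; apply: ((tP i0).2 t) => //; apply: St; right.
split=> [s i [Ss|->]|s s' i [Ss|->] [Ss'|->]]; [exact: SA|exact: (tP i).1| | | |by []].
- exact: Sinj.
- by move=> e; case: ((tP i).2 _ Ss e).
- by move=> e; case: ((tP i).2 _ Ss' (esym e)).
Qed.

Lemma card_total T U (A : set T) (B : set U) : A #<= B \/ B #<= A.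
Proof.
(* Comparing two sets is [card_min] for a family of two; the sum type puts both into one ambient
   type. *)
pose C (b : bool) : set (T + U) := if b then inl @` A else inr @` B.
have CA : C true #= A by apply: inj_card_eq => x y _ _ [].
have CB : C false #= B by apply: inj_card_eq => x y _ _ [].
have [[] iP] := card_min C true.
  left; move: (iP false); by rewrite (card_le_eql CA) (card_le_eqr CB).
right; move: (iP true); by rewrite (card_le_eql CB) (card_le_eqr CA).
Qed.

Lemma card_nle T U (A : set T) (B : set U) : ~ (A #<= B) -> B #<= A.
Proof. by case: (card_total A B). Qed.

Lemma infinite_le T U (A : set T) (B : set U) :
  A #<= B -> infinite_set A -> infinite_set B.
Proof. by move=> AB; apply: contra_not; exact: card_le_finite. Qed.

Lemma card_setX T U T' U' (A : set T) (B : set U) (A' : set T') (B' : set U') :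
  A #<= A' -> B #<= B' -> A `*` B #<= A' `*` B'.
Proof.
move=> AA BB; have [A0|/set0P[a Aa]] := eqVneq A set0.
  by rewrite A0 set0X card_ge0.
have [B0|/set0P[b Bb]] := eqVneq B set0.
  by rewrite B0 setX0 card_ge0.
have [f fA finj] := card_le_ex AA (ex_intro _ a Aa).
have [g gB ginj] := card_le_ex BB (ex_intro _ b Bb).
apply: (card_le_fun (f := fun z => (f z.1, g z.2))) => [[x y] [/= Ax By]|].
  by split; [exact: fA|exact: gB].
by move=> [x y] [x' y'] [/= Ax By] [/= Ax' By'] [/finj-> // /ginj->].
Qed.

(** The square of [Q] appears as a hypothesis because this bound is used inside the proof that
    infinite sets absorb their squares. *)
Lemma card_setU_sq T U (A B : set T) (Q : set U) : infinite_set Q ->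
  Q `*` Q #<= Q -> A #<= Q -> B #<= Q -> A `|` B #<= Q.
Proof.
move=> Qinf QQ AQ BQ; apply: card_le_trans QQ.
have /infiniteP/card_le_ex[|e eQ einj] := Qinf; first by exists 0.
have q0 := eQ 0 I; have [A0|/set0P An0] := eqVneq A set0.
  rewrite A0 set0U; apply: card_le_trans BQ _.
  by apply: (card_le_fun (f := fun x => (e 0, x))) => // x y _ _ [].
have [B0|/set0P Bn0] := eqVneq B set0.
  rewrite B0 setU0; apply: card_le_trans AQ _.
  by apply: (card_le_fun (f := fun x => (e 0, x))) => // x y _ _ [].
have [f fA finj] := card_le_ex AQ An0; have [g gB ginj] := card_le_ex BQ Bn0.
apply: (card_le_rel (R := fun x z =>
   A x /\ z = (e 0, f x) \/ B x /\ z = (e 1, g x))).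
  move=> x [Ax|Bx].
    by exists (e 0, f x); [split => //; exact: fA|left].
  by exists (e 1, g x); [split => //; [exact: eQ|exact: gB]|right].
move=> x x' y _ _ _ [[Ax ->]|[Bx ->]] [[Ax' []]|[Bx' []]].
- by move=> /finj->.
- by move=> h _; have := einj _ _ I I h.
- by move=> h _; have := einj _ _ I I h.
- by move=> /ginj->.
Qed.

(** Zorn's lemma on graphs of injective pairings of a set with itself; the underlying set [Dm G] is
    read off the diagonal. The set [A] of a maximal pairing turns out to have the size of the whole
    type. *)
Lemma card_sqT T : infinite_set [set: T] -> [set: T * T] #<= [set: T].
Proof.
move=> Tinf; pose Dm (G : set (T * T * T)) := [set x | exists z, G (x, x, z)].
pose P := [set G : set (T * T * T) |
  [/\ forall x y z, G (x, y, z) -> [/\ Dm G x, Dm G y & Dm G z],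
      forall x y, Dm G x -> Dm G y -> exists z, G (x, y, z) &
      forall x y x' y' z, G (x, y, z) -> G (x', y', z) -> x = x' /\ y = y']].
have [] := @Zorn_bigcup _ P.
  move=> F FP Ftot; have sub G : F G -> Dm G `<=` Dm (\bigcup_(X in F) X).
    by move=> FG x [z Gz]; exists z, G.
  split.
  - move=> x y z [G FG Gxyz]; have [/(_ _ _ _ Gxyz)[]] := FP _ FG.
    by move=> *; split; exact: (sub _ FG).
  - move=> x y [z [G FG Gx]] [z' [G' FG' Gy]].
    have [GG|GG] := Ftot _ _ FG FG'.
      have [_ h _] := FP _ FG'; have [|/=|w Gw] := h x y; last by exists w, G'.
      by exists z; exact: GG.
      by exists z'.
    have [_ h _] := FP _ FG; have [|/=|w Gw] := h x y; last by exists w, G.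
    by exists z.
    by exists z'; exact: GG.
  - move=> x y x' y' z [G FG Gx] [G' FG' Gy].
    have [GG|GG] := Ftot _ _ FG FG'.
      by have [_ _ h] := FP _ FG'; apply: h Gy; exact: GG.
    by have [_ _ h] := FP _ FG; apply: h (GG _ Gy).
move=> G [[Gsub Gtot Ginj] Gmax]; set A := Dm G.
have AA : A `*` A #<= A.
  apply: (card_le_rel (R := fun p z => G (p.1, p.2, z))).
    move=> [x y] [/= Ax Ay]; have [z Gz] := Gtot _ _ Ax Ay.
    by exists z => //; have [] := Gsub _ _ _ Gz.
  by move=> [x y] [x' y'] z _ _ _ /= h /(Ginj _ _ _ _ _ h) [-> ->].
(* A copy [C] of [Q] outside [A] would extend the pairing to the union of [A] and [C]: all new pairs
   are sent into [C], so they never clash with old values, which lie in [A]. *)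
have ext U (Q : set U) : infinite_set Q -> Q `*` Q #<= Q -> A #<= Q ->
    ~ (Q #<= ~` A).
  move=> Qinf QQ AQ /card_le_ex[]; first exact: infinite_setN0.
  move=> f fA finj; pose C := f @` Q.
  have CQ : C #<= Q by exact: card_image_le.
  have : (A `|` C) `*` (A `|` C) #<= Q.
    by apply: (card_le_trans _ QQ); apply: card_setX; apply: card_setU_sq => //.
  have [q Qq] := infinite_setN0 Qinf.
  have Cfq : C (f q) by exists q.
  move=> /card_le_ex[]; first by exists (f q, f q); split; right.
  move=> g gQ ginj; pose G' := G `|` [set t | [/\ (A `|` C) t.1.1, (A `|` C) t.1.2,
    ~ (A `*` A) (t.1.1, t.1.2) & t.2 = f (g (t.1.1, t.1.2))]].
  have GC x y z : G (x, y, z) -> ~ C z.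
    by move=> /Gsub[_ _ Az] [u Qu fz]; apply: (fA _ Qu); rewrite fz.
  have DmG' : Dm G' = A `|` C.
    apply/seteqP; split=> [x [z [Gx|[//]]]|x [[z Gz]|Cx]].
    - by left; exists z.
    - by exists z; left.
    - exists (f (g (x, x))); right; split => //=; try by right.
      move=> [/= Ax _]; case: Cx => u Qu fu; apply: (fA u Qu); by rewrite fu.
  apply: (Gmax G').
    split; first by apply: subsetUl.
    move=> /(_ (f q, f q, f (g (f q, f q)))) sub.
    have : G (f q, f q, f (g (f q, f q))).
      apply: sub; right; split => //=; try by right.
      by move=> [/= Aq _]; exact: (fA q Qq).
    by move=> /Gsub[Aq _ _]; exact: (fA q Qq).
  split; rewrite ?DmG'.
  - move=> x y z [/Gsub[Ax Ay Az]|[/= Ax Ay _ ->]].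
      by split; left.
    by split => //; right; exists (g (x, y)) => //; apply: gQ.
  - move=> x y Ax Ay; have [[Ax' Ay']|nAA] := pselect ((A `*` A) (x, y)).
      by have [z Gz] := Gtot _ _ Ax' Ay'; exists z; left.
    by exists (f (g (x, y))); right.
  - move=> x y x' y' z [Gz|[/= Ax Ay _ ez]] [Gz'|[/= Ax' Ay' _ ez']].
    + exact: Ginj Gz'.
    + by case: (GC _ _ _ Gz); rewrite ez'; exists (g (x', y')) => //; apply: gQ.
    + by case: (GC _ _ _ Gz'); rewrite ez; exists (g (x, y)) => //; apply: gQ.
    + have : g (x, y) = g (x', y').
        by apply: finj; rewrite -?ez //; apply: gQ.
      by move=> h; have [-> ->] : (x, y) = (x', y') by apply: ginj.
(* A finite [A] leaves room for a copy of [nat]; for infinite [A] the choice [Q = A] shows that the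
   complement is no larger than [A]. *)
have [Afin|Ainf] := pselect (finite_set A).
  have [] := ext _ [set: nat].
  - exact: infinite_nat.
  - by rewrite setXTT; have := card_nat2; rewrite card_eq_le => /andP[].
  - exact: finite_set_countable.
  - apply/infiniteP => cfin; apply: Tinf.
    by rewrite -(setUv A) finite_setU.
have [AcA|/(ext _ _ Ainf AA (card_lexx _))//] := card_total (~` A) A.
have TA : [set: T] #<= A.
  by rewrite -(setUv A); apply: card_setU_sq.
rewrite -setXTT; apply: card_le_trans (card_leT A).
by apply: card_le_trans AA; apply: card_setX.
Qed.

Lemma card_sq T (A : set T) : infinite_set A -> A `*` A #<= A.
Proof.
move=> Ainf; have eA : [set: A] #= A by exact: card_setT.
have eA' : A #= [set: A] by exact: card_esym.
rewrite -(card_le_eqr eA); apply: card_le_trans (card_sqT _); last first.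
  by apply: infinite_le Ainf; move: eA'; rewrite card_eq_le => /andP[].
rewrite -setXTT; move: eA'; rewrite card_eq_le => /andP[h _].
exact: card_setX.
Qed.

Lemma card_leX T U V (A : set T) (B : set U) (Q : set V) : infinite_set Q ->
  A #<= Q -> B #<= Q -> A `*` B #<= Q.
Proof.
by move=> Qinf AQ BQ; apply: card_le_trans (card_sq Qinf); exact: card_setX.
Qed.

Lemma card_leU T U (A B : set T) (Q : set U) : infinite_set Q ->
  A #<= Q -> B #<= Q -> A `|` B #<= Q.
Proof. by move=> Qinf; apply: card_setU_sq => //; exact: card_sq. Qed.

Lemma card_le_bigcup I T U (D : set I) (F : I -> set T) (Q : set U) :
  infinite_set Q -> D #<= Q -> (forall i, D i -> F i #<= Q) ->
  \bigcup_(i in D) F i #<= Q.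
Proof.
move=> Qinf DQ FQ; have [q Qq] := infinite_setN0 Qinf.
have /choice[f fP] i : exists f : T -> U, D i -> (forall x, F i x -> Q (f x)) /\
    (forall x y, F i x -> F i y -> f x = f y -> x = y).
  have [Di|nDi] := pselect (D i); last by exists (fun=> q).
  have [F0|/set0P Fn0] := eqVneq (F i) set0.
    by exists (fun=> q); rewrite F0; split.
  by have [f] := card_le_ex (FQ i Di) Fn0; exists f.
apply: card_le_trans (card_leX Qinf DQ (card_lexx Q)).
apply: (card_le_rel (R := fun x z => F z.1 x /\ z.2 = f z.1 x)).
  by move=> x [i Di Fix]; exists (i, f i x) => //; split => //; apply: (fP i Di).1.
move=> x x' [i y] _ _ [/= Di _] [Fx ->] [Fx']; exact: (fP i Di).2.
Qed.

(** Iterating a pairing function encodes a list, with [q] for the empty one. The length is recorded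
    as well, since [q] may also be a value of the pairing. *)
Lemma card_le_seq (T : eqType) U (A : set T) (Q : set U) : infinite_set Q ->
  A #<= Q -> [set s : seq T | {in s, forall x, A x}] #<= Q.
Proof.
move=> Qinf AQ; have [q Qq] := infinite_setN0 Qinf.
have [A0|/set0P An0] := eqVneq A set0.
  apply: (card_le_fun (f := fun=> q)) => // s s' sA s'A _.
  case: s sA => [_|x s /(_ x)]; last by rewrite A0 mem_head => /(_ isT).
  by case: s' s'A => // x s /(_ x); rewrite A0 mem_head => /(_ isT).
have [f fA finj] := card_le_ex AQ An0.
have [|p pQ pinj] := card_le_ex (card_sq Qinf); first by exists (q, q).
have /infiniteP/card_le_ex[|e eQ einj] := Qinf; first by exists 0.
pose c := foldr (fun x a => p (f x, a)) q.
have cQ s : {in s, forall x, A x} -> Q (c s).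
  elim: s => //= x s IH sA; apply: pQ; split => /=.
    by apply/fA/sA; rewrite mem_head.
  by apply: IH => y ys; apply: sA; rewrite in_cons ys orbT.
apply: (card_le_fun (f := fun s => p (e (size s), c s))) => [s sA|s s' sA s'A].
  by apply: pQ; split; [exact: eQ|exact: cQ].
move=> h; have [es ec] : (e (size s), c s) = (e (size s'), c s').
  by apply: pinj => //; split; [exact: eQ|exact: cQ|exact: eQ|exact: cQ].
have {es h} sz := einj _ _ I I es.
elim: s s' sz ec sA s'A => [|x s IH] [|x' s'] //= [sz] ec sA s'A.
have sA' : {in s, forall y, A y} by move=> y ys; apply: sA; rewrite in_cons ys orbT.
have s'A' : {in s', forall y, A y} by move=> y ys; apply: s'A; rewrite in_cons ys orbT.
have Ax : A x by apply/sA/mem_head.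
have Ax' : A x' by apply/s'A/mem_head.
have [ef es] : (f x, c s) = (f x', c s').
  by apply: pinj => //; split; [exact: fA|exact: cQ|exact: fA|exact: cQ].
by rewrite (finj x x') // (IH s').
Qed.

(** * Initial well-orders *)

(** A well-order whose type is a cardinal. By totality the set in [io_small] is the closed segment
    up to [x]. *)
Record initial_order (K : Type) (lt : K -> K -> Prop) : Prop := InitialOrder {
  io_wf : well_founded lt;
  io_trans : forall x y z, lt x y -> lt y z -> lt x z;
  io_total : forall x y, [\/ lt x y, x = y | lt y x];
  io_small : forall x, ~ ([set: K] #<= [set y | ~ lt x y]) }.

(** If some segment of a well-order has full size, take the least such endpoint and pull the order
    back along an injection of [K] into its segment; proper segments then become small. *)
Lemma initial_order_exists (K : choiceType) : infinite_set [set: K] ->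
  exists lt : K -> K -> Prop, initial_order lt.
Proof.
move=> Kinf; have [R Rwo] := well_ordering_principle K.
have Rtot : forall x y, R x y || R y x.
  have wc : wo_chain R predT by move=> A _; exact: Rwo.
  by move=> x y; apply: (wo_chainW wc).
have Ranti : antisymmetric R.
  have wc : wo_chain R predT by move=> A _; exact: Rwo.
  by move=> x y; apply: (wo_chain_antisymmetric wc).
have Rmin (A : set K) : A !=set0 -> exists2 z, A z & forall x, A x -> R z x.
  move=> [a Aa]; have [|z [[zA zl] _]] := Rwo (fun x => `[< A x >]).
    by exists a; apply/asboolP.
  by exists z => [|x Ax]; [apply/asboolP|apply: zl; apply/asboolP].
have Rtr : transitive R.
  move=> y x z xy yz; have [|w] := Rmin [set x; y; z]; first by exists x; left; left.
  have Rxx u : R u u by have := Rtot u u; rewrite orbb.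
  move=> [[->|->]|->] h.
  - by apply: h; right.
  - have Ryx : R y x by apply: h; left; left.
    by have -> : x = y by apply: Ranti; rewrite xy.
  - have Rzy : R z y by apply: h; left; right.
    by have <- : y = z by apply: Ranti; rewrite yz.
pose r x y := R x y /\ x <> y.
have rtr x y z : r x y -> r y z -> r x z.
  move=> [xy nxy] [yz nyz]; split; first exact: Rtr yz.
  by move=> xz; apply: nxy; apply: Ranti; rewrite xy xz.
have rtot x y : [\/ r x y, x = y | r y x].
  have [->|nxy] := pselect (x = y); first by constructor 2.
  by have /orP[] := Rtot x y => h; [constructor 1|constructor 3]; split => // /esym.
have rirr x : ~ r x x by case.
have rwf : well_founded r.
  move=> x; apply: contrapT => nax.
  have [|z nz zl] := Rmin [set x | ~ Acc r x]; first by exists x.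
  apply: nz; constructor => y [yz nyz]; apply: contrapT => /zl zy.
  by apply: nyz; apply: Ranti; rewrite yz.
have [f finj fsmall] : exists2 f : K -> K, injective f &
    forall a, ~ ([set: K] #<= [set y | r y (f a)]).
  have [[x bad]|nobad] := pselect (exists x, [set: K] #<= [set y | r y x]); last first.
    by exists id => // a ha; apply: nobad; exists a.
  have [|z zbad zl] := Rmin [set x | [set: K] #<= [set y | r y x]]; first by exists x.
  have [|f fA finj] := card_le_ex zbad; first by exists x.
  exists f => [a b|a /zl za]; first exact: finj.
  have [faz nfaz] := fA a I; apply: nfaz; apply: Ranti; by rewrite faz.
exists (fun a b => r (f a) (f b)); split.
- move=> x; suff : forall z, Acc r z -> forall x, z = f x ->
      Acc (fun a b => r (f a) (f b)) x by apply.
  by move=> z; elim => {}z _ IH {}x ez; constructor => y yx; apply: (IH (f y)); rewrite // ez.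
- by move=> x y z; exact: rtr.
- move=> x y; have [] := rtot (f x) (f y) => h.
  + by constructor 1.
  + by constructor 2; apply: finj.
  + by constructor 3.
- move=> x Kle; have /(_ x)/= := fsmall; apply.
  set S := [set y | r y (f x)].
  have segU : [set y | ~ r (f x) (f y)] `<=` [set y | r (f y) (f x)] `|` [set x].
    move=> y /= nxy; have [//|/finj ->|] := rtot (f y) (f x); [by left|by right|by []].
  have KU := card_le_trans Kle (subset_card_le segU).
  have Sinf : infinite_set [set y | r (f y) (f x)].
    have := infinite_le KU Kinf; apply: contra_not => h.
    by rewrite finite_setU; split => //; exact: finite_set1.
  have le : [set y | r (f y) (f x)] #<= S by apply: (card_le_fun (f := f)) => // ? ? _ _ /finj.
  apply: card_le_trans le; apply: card_le_trans KU _; apply: card_leU => //.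
  by apply: card_le_trans (finite_set_countable (finite_set1 x)) _; apply/infiniteP.
Qed.

(** Transfinite recursion with a choice at each stage. The hypothesis that [Q x] depends only on
    values below [x] allows the function built so far to be padded with [t0]. *)
Lemma wf_choice (K T : Type) (lt : K -> K -> Prop) (t0 : T)
    (Q : K -> (K -> T) -> T -> Prop) : well_founded lt ->
  (forall x f g t, (forall y, lt y x -> f y = g y) -> Q x f t -> Q x g t) ->
  (forall x f, (forall y, lt y x -> Q y f (f y)) -> exists t, Q x f t) ->
  exists f, forall x, Q x f (f x).
Proof.
move=> wf loc ex.
pose pick x (f : K -> T) : T :=
  if pselect (exists t, Q x f t) is left h then projT1 (cid h) else t0.
pose ext x (g : forall y, lt y x -> T) y :=
  if pselect (lt y x) is left h then g y h else t0.
pose F x (g : forall y, lt y x -> T) : T := pick x (ext x g).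
pose f := Fix wf (fun=> T) F.
have fE x : f x = pick x (ext x (fun y _ => f y)).
  rewrite /f Fix_eq // => {}x g h gh; rewrite /F.
  suff -> : ext x g = ext x h by [].
  by apply/funext => y; rewrite /ext; case: pselect.
exists f; apply: (well_founded_ind wf) => x IH.
have agree y : lt y x -> f y = ext x (fun y _ => f y) y.
  by rewrite /ext; case: pselect.
have [t Qt] : exists t, Q x f t by apply: ex.
rewrite fE; apply: (loc x (ext x (fun y _ => f y))) => [y /agree//|].
rewrite /pick; case: pselect => [h|[]]; first by case: cid.
by exists t; apply: (loc x f).
Qed.

Lemma io_irr (K : Type) (lt : K -> K -> Prop) x : initial_order lt -> ~ lt x x.
Proof.
move=> io; elim: (io_wf io x) => {}x _ IH xx; exact: (IH x xx xx).
Qed.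

Lemma io_asym (K : Type) (lt : K -> K -> Prop) x y :
  initial_order lt -> lt x y -> ~ lt y x.
Proof. by move=> io xy /(io_trans io xy); exact: io_irr. Qed.

Lemma io_seg (K : Type) (lt : K -> K -> Prop) x :
  initial_order lt -> ~ ([set: K] #<= [set y | lt y x]).
Proof.
move=> io le; apply: (io_small io (x := x)); apply: card_le_trans le _.
by apply: subset_card_le => y /= yx; exact: io_asym io yx.
Qed.

Lemma io_min (K : Type) (lt : K -> K -> Prop) (A : set K) : initial_order lt ->
  A !=set0 -> exists2 x, A x & forall y, lt y x -> ~ A y.
Proof.
move=> io [x0]; elim: (io_wf io x0) => {x0} x _ IH Ax.
have [[y yx Ay]|h] := pselect (exists2 y, lt y x & A y); first exact: IH Ay.
by exists x => // y yx Ay; apply: h; exists y.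
Qed.

Lemma io_seq_max (K : eqType) (lt : K -> K -> Prop) (s : seq K) : initial_order lt ->
  s != [::] -> exists2 m, m \in s & {in s, forall j, j = m \/ lt j m}.
Proof.
move=> io; elim: s => // x s IH _; have [->|/IH[m ms mP]] := eqVneq s [::].
  by exists x; rewrite ?mem_head // => j; rewrite inE => /eqP; left.
have [xm|xm|xm] := io_total io x m.
- exists m; first by rewrite inE ms orbT.
  by move=> j; rewrite inE => /orP[/eqP->|/mP//]; right.
- exists m; first by rewrite inE ms orbT.
  by move=> j; rewrite inE => /orP[/eqP->|/mP//]; left.
- exists x; first by rewrite mem_head.
  move=> j; rewrite inE => /orP[/eqP->|/mP[->|jm]]; [by left|by right|].
  by right; exact: io_trans io _ _ _ jm xm.
Qed.

(** The larger of two cardinals below that of [K] is again below it, and being infinite it absorbs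
    finite sequences and products. *)
Lemma card_small_cover (K : Type) (L A : set K) :
  infinite_set L -> ~ ([set: K] #<= L) -> ~ ([set: K] #<= A) ->
  exists Q : set K, [/\ infinite_set Q, A #<= Q, L #<= Q & ~ ([set: K] #<= Q)].
Proof.
move=> Linf nKL nKA; have [AL|LA] := card_total A L.
  by exists L; split.
by exists A; split => //; exact: infinite_le Linf.
Qed.

(** * Compacta and characters of points *)

Section Topology.
Variable X : topologicalType.
Hypothesis Xc : compactum X.

Lemma compact_centered (I : choiceType) (f : I -> set X) :
  (forall i, closed (f i)) ->
  (forall s : seq I, exists x, {in s, forall i, f i x}) -> exists x, forall i, f i x.
Proof.
move=> fcl fs; have fI : finI setT f.
  by move=> D' _; have [x xP] := fs (finmap.enum_fset D'); exists x => i /= iD; exact: xP.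
have FF := finI_filter fI.
have [|x [_ xcl]] := Xc.1 _ FF; first exact: filterT.
exists x => i; apply: fcl => B nB; apply: xcl => //.
by exists (f i) => //; apply: finI_from1.
Qed.

Lemma compact_subcover (I : choiceType) (f : I -> set X) :
  (forall i, open (f i)) -> (forall x, exists i, f i x) ->
  exists s : seq I, forall x, exists2 i, i \in s & f i x.
Proof.
move=> fop fcov; apply: contrapT => /forallNP ns.
have [||x xP] := @compact_centered I (fun i => ~` f i).
- by move=> i; exact: open_closedC.
- move=> s; have /existsNP[x /forall2NP xs] := ns s.
  by exists x => i si; have [] := xs i.
- by have [i] := fcov x; exact: xP.
Qed.

Lemma regular_nbhs (x : X) N : nbhs x N ->
  exists U, [/\ open U, U x & closure U `<=` N].
Proof.
move=> xN; have [V Vx VN] := compact_regular Xc.2 Xc.1 filterT xN.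
exists V°; split; [exact: open_interior|exact: Vx|].
by apply: subset_trans VN; apply: closureS; exact: interior_subset.
Qed.

Lemma hausdorff_open_sep (x y : X) : x <> y ->
  exists U V, [/\ open U, open V, U x, V y & U `&` V = set0].
Proof.
move=> /eqP xy; have := Xc.2; rewrite open_hausdorff => /(_ _ _ xy).
by move=> [[U V] /= [/set_mem ? /set_mem ?] [? ? /eqP ?]]; exists U, V.
Qed.

Lemma open_seqI (I : eqType) (f : I -> set X) (s : seq I) :
  {in s, forall i, open (f i)} -> open [set y | {in s, forall i, f i y}].
Proof.
elim: s => [_|i s IH sop].
  by rewrite (_ : [set _ | _] = setT); [exact: openT|apply/seteqP; split].
rewrite (_ : [set _ | _] = f i `&` [set y | {in s, forall i, f i y}]).
  apply: openI; first by apply: sop; rewrite mem_head.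
  by apply: IH => j js; apply: sop; rewrite inE js orbT.
apply/seteqP; split=> y /= => [h|[fi h] j].
  by split=> [|j js]; apply: h; rewrite inE ?eqxx ?js ?orbT.
by rewrite inE => /orP[/eqP->|/h].
Qed.

(** Pseudocharacter bounds character in a compactum: if no finite intersection fits into [N],
    compactness yields a point of all the closures outside the interior of [N], which cannot be
    [q]. *)
Lemma pseudo_local_base (I : choiceType) (D : set I) (f : I -> set X) q :
  (forall i, D i -> open (f i) /\ f i q) ->
  (forall y, (forall i, D i -> closure (f i) y) -> y = q) ->
  local_base q [set [set y | {in s, forall i, f i y}]
                 | s in [set s : seq I | {in s, forall i, D i}]].
Proof.
move=> fD fq; split.
  move=> _ [s /= sD <-]; split.
    by apply: open_seqI => i /sD /fD[].
  by move=> i /sD /fD[].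
move=> N nN; apply: contrapT => noU.
(* The extra index [None] carries the complement of the interior of [N]. *)
pose g (o : option I) := if o is Some i then
  (if pselect (D i) then closure (f i) else setT) else ~` N°.
have [||x xP] := @compact_centered _ g.
- move=> [i|] /=; first by case: pselect => ?; [exact: closed_closure|exact: closedT].
  by apply: open_closedC; exact: open_interior.
- move=> s; pose s' := [seq i <- pmap id s | `[< D i >]].
  have s'D : {in s', forall i, D i}.
    by move=> i; rewrite mem_filter => /andP[/asboolP].
  apply: contrapT => /forallNP ns; apply: noU.
  exists [set y | {in s', forall i, f i y}]; first by exists s'.
  move=> y /= ys'; apply: contrapT => nNy; apply: (ns y) => -[i|] si /=.
    case: pselect => // Di; apply/subset_closure/ys'.
    by rewrite mem_filter mem_pmap; apply/andP; split; [exact/asboolP|apply/mapP; exists (Some i)].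
  by move=> /interior_subset.
- have xq : x = q.
    by apply: fq => i Di; have := xP (Some i); rewrite /=; case: pselect.
  by have /= := xP None; rewrite xq.
Qed.

(** Since each closure lies in the preceding set, the intersection of the sequence is closed while
    its members are open. *)
Lemma nested_opens (y : X) (U : set X) : open U -> U y ->
  exists t : nat -> set X, [/\ t 0 = U, forall n, open (t n), forall n, t n y &
    forall n, closure (t n.+1) `<=` t n].
Proof.
move=> Uo Uy; have /choice[r rP] V : exists W, open V -> V y ->
    [/\ open W, W y & closure W `<=` V].
  have [[Vo Vy]|h] := pselect (open V /\ V y).
    by have [W] := regular_nbhs (open_nbhs_nbhs (conj Vo Vy)); exists W.
  by exists set0 => Vo Vy; case: h.
exists (fun n => iter n r U).
have tP n : open (iter n r U) /\ iter n r U y.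
  by elim: n => [//|n [/rP h /h[]]].
split=> // n; [exact: (tP n).1|exact: (tP n).2|].
by have [/rP h /h[]] := tP n.
Qed.

End Topology.

Lemma lt_cellularity_le (X : topologicalType) T U (A : set T) (B : set U) :
  A #<= B -> lt_cellularity X B -> lt_cellularity X A.
Proof.
move=> AB [Bfin|[F [Fc [BF nFB]]]]; first by left; exact: card_le_finite Bfin.
right; exists F; split => //; split; first exact: card_le_trans BF.
by apply: contra_not nFB => FA; exact: card_le_trans AB.
Qed.

(** At stage [k] fewer than |K| sets have been chosen, so they are not a local base: some
    neighbourhood contains none of them, and it is intersected with [e k]. *)
Lemma local_base_noncontaining (X : topologicalType) (p : X) (K : choiceType)
    (lt : K -> K -> Prop) (e : K -> set X) : initial_order lt ->
  local_base p (range e) -> (forall B, local_base p B -> [set: K] #<= B) ->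
  exists U : K -> set X, local_base p (range U) /\
    forall j k, U j `<=` U k -> ~ lt j k.
Proof.
move=> io [eop eb] Kmin.
have [U UP] : exists U : K -> set X, forall k,
   [/\ open (U k), U k p, U k `<=` e k & forall j, lt j k -> ~ (U j `<=` U k)].
  apply: (@wf_choice _ _ lt set0 (fun k f t =>
    [/\ open t, t p, t `<=` e k & forall j, lt j k -> ~ (f j `<=` t)])).
  - exact: io_wf.
  - by move=> x f g t fg [? ? ? h]; split=> // j jx; rewrite -fg //; exact: h.
  move=> k f fP; have [N nN Nf] : exists2 N, nbhs p N & forall j, lt j k -> ~ (f j `<=` N).
    apply: contrapT => noN; apply: (@io_seg _ _ k io).
    apply: card_le_trans (Kmin (f @` [set y | lt y k]) _) (card_image_le _ _).
    split=> [_ [j jk <-]|N nN]; first by have [] := fP _ jk.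
    apply: contrapT => nU; apply: noN; exists N => // j jk fN; apply: nU.
    by exists (f j) => //; exists j.
  have [eo ep] : open (e k) /\ e k p by apply: eop; exists k.
  exists (N° `&` e k); split.
  - by apply: openI => //; exact: open_interior.
  - by split.
  - by move=> y [].
  - by move=> j jk fj; apply: (Nf j jk) => y /fj[] /interior_subset.
exists U; split; first split.
- by move=> _ [k _ <-]; have [] := UP k.
- move=> N /eb[_ [k _ <-] ekN]; exists (U k); first by exists k.
  by apply: subset_trans ekN; have [] := UP k.
- by move=> j k Ujk jk; have [_ _ _ /(_ _ jk)] := UP k.
Qed.

(** A finite subfamily has a largest index in [D], and the point supplied for that index lies in
    every member of the subfamily. *)
Lemma nested_closed_centered (X : topologicalType) (K : choiceType)
    (lt : K -> K -> Prop) (D : set K) (f : K -> nat -> set X) (x0 : X) :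
  compactum X -> initial_order lt ->
  (forall k n, D k -> closure (f k n.+1) `<=` f k n) ->
  (forall k, D k -> exists y, (forall j n, lt j k -> f j n y) /\ forall n, f k n y) ->
  exists y, forall k n, D k -> f k n y.
Proof.
move=> Xc io fcl fD.
pose g (z : K * nat) := if pselect (D z.1) then closure (f z.1 z.2) else setT.
have [||y yP] := @compact_centered X Xc _ g.
- move=> [k n]; rewrite /g /=; case: pselect => ?; [exact: closed_closure|exact: closedT].
- move=> s; pose s' := [seq z.1 | z <- s & `[< D z.1 >]].
  have [s0|/(io_seq_max io)[m ms mP]] := eqVneq s' [::].
    exists x0 => -[k n] zs; rewrite /g /=; case: pselect => // Dk.
    suff : k \in s' by rewrite s0.
    by apply/mapP; exists (k, n) => //; rewrite mem_filter zs andbT; apply/asboolP.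
  have Dm : D m by move: ms => /mapP[z]; rewrite mem_filter => /andP[/asboolP ? _ ->].
  have [y [y1 y2]] := fD _ Dm; exists y => -[k n] zs; rewrite /g /=.
  case: pselect => // Dk; apply: subset_closure.
  have [|->//|] := mP k; last exact: y1.
  by apply/mapP; exists (k, n) => //; rewrite mem_filter zs andbT; apply/asboolP.
exists y => k n Dk; apply: fcl => //.
by have := yP (k, n.+1); rewrite /g /=; case: pselect.
Qed.

(** Given an enumeration of the points by [K], stage [k] adds a nested sequence of open sets whose
    first term omits [x k]; a point common to all stages is then not enumerated. *)
Lemma character_lt_card (X : topologicalType) (K : choiceType)
    (lt : K -> K -> Prop) (L : set K) : compactum X -> initial_order lt ->
  infinite_set L -> ~ ([set: K] #<= L) -> [set: X] !=set0 ->
  (forall q (B : set (set X)), local_base q B -> [set: K] #<= B) ->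
  ~ ([set: X] #<= [set: K]).
Proof.
move=> Xc io Linf nKL X0 Kmin XK.
have [x0 _] := X0; have [x xE] := card_ge_ex XK X0.
pose ok k (t : nat -> set X) := [/\ forall n, open (t n),
  forall n, closure (t n.+1) `<=` t n & ~ t 0 (x k)].
have [f fP] : exists f : K -> nat -> set X, forall k, ok k (f k) /\
   exists y, (forall j n, lt j k -> f j n y) /\ forall n, f k n y.
  apply: (@wf_choice _ _ lt (fun=> set0) (fun k f t => ok k t /\
     exists y, (forall j n, lt j k -> f j n y) /\ forall n, t n y)).
  - exact: io_wf.
  - move=> k f g t fg [kt [y [y1 y2]]]; split => //; exists y; split => // j n jk.
    by rewrite -fg //; exact: y1.
  move=> k f fP.
  have [y0 y0P] : exists y, forall j n, lt j k -> f j n y.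
    apply: (@nested_closed_centered X K lt [set j | lt j k] f x0 Xc io).
      by move=> j n jk; have [[_ h _] _] := fP j jk; exact: h.
    by move=> j jk; have [_ h] := fP j jk.
  have [y yP yx] : exists2 y, forall j n, lt j k -> f j n y & y <> x k.
    apply: contrapT => noy.
    have only y : (forall j n, lt j k -> f j n y) -> y = x k.
      by move=> yP; apply: contrapT => yx; apply: noy; exists y.
    (* Were [x k] the only common point so far, finite intersections of the earlier sets would form
       a local base there. [L] gives an infinite bound below |K| that absorbs the countably many
       sets per index. *)
    have [Q [Qinf kQ LQ nKQ]] := @card_small_cover K L _ Linf nKL (@io_seg _ _ k io).
    apply: nKQ; pose I := (K * nat)%type.
    have lb := @pseudo_local_base X Xc I ([set j | lt j k] `*` [set: nat])
      (fun z => f z.1 z.2) (x k).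
    apply: card_le_trans (Kmin (x k) _ (lb _ _)) _.
    + move=> [j n] [/= jk _]; have [[h _ _] _] := fP j jk; split => //.
      by rewrite -(only y0) //; exact: y0P.
    + move=> y yP; apply: only => j n jk; have [[_ h _] _] := fP j jk.
      by apply: h; apply: (yP (j, n.+1)).
    apply: card_le_trans (card_image_le _ _) _; apply: card_le_seq => //.
    by apply: card_leX => //; apply/infiniteP.
  have [||t [t0 top ty tcl]] := @nested_opens X Xc y (~` [set x k]).
  - by apply: closed_openC; exact: compact_closed Xc.2 (@compact_set1 _ (x k)).
  - by move=> /= /yx.
  by exists t; split; [split => //; rewrite t0 => /(_ erefl)|exists y].
have [y yP] : exists y, forall k n, setT k -> f k n y.
  apply: (@nested_closed_centered X K lt setT f x0 Xc io).
    by move=> j n _; have [[_ h _] _] := fP j; exact: h.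
  by move=> j _; have [_ h] := fP j.
have [k _ xk] : (x @` setT) y by rewrite -xE.
by have [[_ _]] := fP k; rewrite xk => /(_ (yP k 0 I)).
Qed.

(** * Cardinality of homogeneous compacta *)

(* The closing-off of a point under choosing a point outside the closure of a union
   of |T| members of the given local pi-bases is indexed by well-founded
   T-branching trees; these are coded by subsets of [seq T], which bounds their
   number by 2^|T|. *)
Inductive wtree (T : Type) := WLeaf | WNode of (T -> wtree T) & (T -> T).
Arguments WLeaf {T}.

(** The code lists the graph of the label function at each address [w], an address being the list of
    branches taken from the root. A leaf contributes nothing. *)
Fixpoint wcode T (t : wtree T) (w : seq T) : T -> T -> Prop :=
  match t with
  | WLeaf => fun _ _ => False
  | WNode c i => if w is a :: w' then wcode (c a) w' else fun a b => b = i a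
  end.

Lemma wcode_inj T (a0 : T) (t t' : wtree T) :
  (forall w a b, wcode t w a b <-> wcode t' w a b) -> t = t'.
Proof.
elim: t t' => [|c IH i] [|c' i'] // h.
- by have [_ /(_ erefl)] := h [::] a0 (i' a0).
- by have [/(_ erefl)] := h [::] a0 (i a0).
have -> : i = i' by apply/funext => a; have [/(_ erefl)/=] := h [::] a (i a).
have -> // : c = c'.
by apply/funext => a; apply: IH => w; exact: (h (a :: w)).
Qed.

Lemma image_injective T U (f : T -> U) : injective f ->
  injective (fun A : set T => f @` A).
Proof.
move=> finj A B AB; apply/seteqP; split=> x Ax.
  have : (f @` B) (f x) by rewrite -AB; exists x.
  by move=> [y By /finj <-].
have : (f @` A) (f x) by rewrite AB; exists x.
by move=> [y By /finj <-].
Qed.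

Lemma wtree_power_inj T : infinite_set [set: T] ->
  exists c : wtree T -> set T, injective c.
Proof.
move=> Tinf; have [a0 _] := infinite_setN0 Tinf.
have seqT : [set: seq {classic T}] #<= [set: T].
  apply: card_le_trans (card_le_seq (T := {classic T}) (A := setT) Tinf _).
    exact: subset_card_le.
  exact: (card_lexx [set: T]).
have [|f _ finj] := card_le_ex seqT; first by exists [::].
(* A triple of address, argument and label becomes one list, the two letters [a] and [b] being put
   in front of [w]. *)
pose d (t : wtree T) := [set w : seq T | exists a b w', w = a :: b :: w' /\ wcode t w' a b].
exists (fun t => f @` d t) => t t' /(@image_injective _ _ f) e.
apply: (wcode_inj a0) => w a b.
have {}e : d t = d t' by apply: e => x y; exact: finj.
have tP s : wcode s w a b <-> d s (a :: b :: w).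
  split=> [h|[a' [b' [w' [[-> -> ->]]]]]//]; by exists a, b, w.
by rewrite !tP e.
Qed.

Definition local_pibase (X : topologicalType) (p : X) (B : set (set X)) :=
  (forall U, B U -> open U /\ U !=set0) /\
  (forall N, nbhs p N -> exists2 U, B U & U `<=` N).

Lemma homogeneous_maps (X : topologicalType) (p : X) : homogeneous X ->
  exists h g : X -> X -> X, forall q, [/\ continuous (h q), continuous (g q),
    cancel (h q) (g q), cancel (g q) (h q) & h q p = q].
Proof.
move=> Xh; have /choice[hg hgP] q : exists hg : (X -> X) * (X -> X),
    [/\ continuous hg.1, continuous hg.2, cancel hg.1 hg.2, cancel hg.2 hg.1 & hg.1 p = q].
  by have [h [[g [? ? ? ?] ?]]] := Xh p q; exists (h, g).
by exists (fun q => (hg q).1), (fun q => (hg q).2).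
Qed.

Lemma maximal_disjoint_subfamily (X : Type) (W : set (set X)) :
  exists V : set (set X), [/\ V `<=` W,
    forall A B, V A -> V B -> A <> B -> A `&` B = set0 &
    forall A, W A -> A !=set0 -> exists2 B, V B & A `&` B !=set0].
Proof.
have [V [VW Vtriv Vmax]] := ex_maximal_disjoint_subcollection (fun A : set X => A) W.
exists V; split => //.
  move=> A B VA VB; apply: contra_notP => /eqP/set0P AB; exact: Vtriv.
move=> A WA A0; apply: contrapT => noB.
have disj B : V B -> A `&` B = set0.
  by move=> VB; apply: contrapT => /eqP/set0P AB; apply: noB; exists B.
apply: (Vmax (V `|` [set A])).
- split; first by apply: subsetUl.
  move=> /(_ A) VA; have /disj : V A by apply: VA; right.
  by rewrite setIid => e; move: A0; rewrite e => -[].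
- by move=> B [/VW|->].
- move=> B C [VB|->] [VC|->] BC; [exact: Vtriv| | |by []].
    by have := disj B VB; case: BC => y [? ?] /seteqP[/(_ y)]; case.
  by have := disj C VC; case: BC => y [? ?] /seteqP[/(_ y)]; case.
Qed.

Section Density.
Variables (X : topologicalType) (p : X) (T : Type) (B : X -> T -> set X).
Hypothesis Xc : compactum X.
Hypothesis Bne : forall q i, open (B q i) /\ B q i !=set0.
Hypothesis Bpi : forall q N, nbhs q N -> exists i, B q i `<=` N.
Hypothesis Xcell : forall F : set (set X), cellular F -> F #<= [set: T].

(** The default [p] is returned at a leaf and whenever the union is dense. *)
Fixpoint weval (t : wtree T) : X :=
  match t with
  | WLeaf => p
  | WNode c i => xget p (~` closure (\bigcup_a B (weval (c a)) (i a)))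
  end.

(** If no value lies in [O], shrink [O] to [U] and take a maximal disjoint family [V] of the sets
    [B (weval t) i] missing [U]. It has at most |T| members, and maximality puts every value in the
    closure of its union. That closure omits [U], so the node built from [V] evaluates outside it, a
    contradiction. *)
Lemma weval_dense (O : set X) : open O -> O !=set0 -> exists t, O (weval t).
Proof.
move=> Oo [x Ox]; apply: contrapT => /forallNP nO.
have [U [Uo Ux UO]] := regular_nbhs Xc (open_nbhs_nbhs (conj Oo Ox)).
pose W := [set A | exists t i, A = B (weval t) i /\ A `&` U = set0].
have [V [VW Vd Vm]] := maximal_disjoint_subfamily W.
have VT : V #<= [set: T].
  apply: Xcell; split => // A /VW[t [i [-> _]]]; exact: Bne.
have clV t : closure (\bigcup_(A in V) A) (weval t).
  move=> N nN; have nU : nbhs (weval t) (~` closure U).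
    apply: open_nbhs_nbhs; split; first exact/closed_openC/closed_closure.
    by move=> /UO; exact: nO.
  have [i iP] := Bpi (filterI nN nU).
  have [|A VA [y [By Ay]]] := Vm (B (weval t) i) _ (Bne _ _).2.
    exists t, i; split => //; apply/seteqP; split=> y //= [/iP[_ nUy] Uy].
    by apply: nUy; exact: subset_closure.
  by exists y; split; [exists A|exact: (iP y By).1].
have V0 : V !=set0.
  by have [y [[A VA _] _]] := clV WLeaf setT filterT; exists A.
have [v vE] := card_ge_ex VT V0.
have /choice[ci ciP] a : exists ci : wtree T * T, v a = B (weval ci.1) ci.2.
  have /VW[t [i [-> _]]] : V (v a) by rewrite vE; exists a.
  by exists (t, i).
pose t := WNode (fun a => (ci a).1) (fun a => (ci a).2).
have bE : \bigcup_a B (weval (ci a).1) (ci a).2 = \bigcup_(A in V) A.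
  apply/seteqP; split=> y [].
    by move=> a _ By; exists (v a); rewrite ?ciP // vE; exists a.
  by rewrite vE => _ [a _ <-]; rewrite ciP => By; exists a.
have : (~` closure (\bigcup_(A in V) A)) (weval t).
  rewrite /= bE; apply: (@xgetPex _ p (~` closure (\bigcup_(A in V) A))).
  exists x => clx; have [y [[A VA Ay] Uy]] := clx U (open_nbhs_nbhs (conj Uo Ux)).
  have [t' [i [_ /seteqP[/(_ y) AU _]]]] := VW _ VA.
  by apply: AU.
by apply; exact: clV.
Qed.

End Density.

(** Transport the pi-base from [p] to every [q], and let [q] be coded by trees whose values lie in
    the sets [B q i]. If distinct points had equal codes, some [b i] pulled back to both would put
    one tree value in two disjoint open sets. *)
Lemma homogeneous_card_le (X : topologicalType) (p : X) (T : Type) (P : set (set X)) :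
  compactum X -> homogeneous X -> infinite_set [set: T] ->
  (forall F : set (set X), cellular F -> F #<= [set: T]) ->
  local_pibase p P -> P #<= [set: T] -> [set: X] #<= [set: set T].
Proof.
move=> Xc Xh Tinf Xcell [Pne Ppi] PT.
have [h [g hgP]] := homogeneous_maps p Xh.
have P0 : P !=set0 by have [U PU _] := Ppi setT filterT; exists U.
have [b bE] := card_ge_ex PT P0.
have bP i : P (b i) by rewrite bE; exists i.
pose B q i := g q @^-1` b i.
have Bne q i : open (B q i) /\ B q i !=set0.
  have [hc gc hg gh hp] := hgP q; have [bo [y bi]] := Pne _ (bP i).
  split; first by apply: open_comp => // y' _; exact: gc.
  by exists (h q y); rewrite /B /= hg.
have Bpi' q N : nbhs (h q p) N -> exists i, b i `<=` h q @^-1` N.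
  have [hc _ _ _ _] := hgP q.
  move=> /hc /Ppi[U PU UN]; move: PU UN; rewrite bE => -[i _ <-]; by exists i.
have Bpi q N : nbhs q N -> exists i, B q i `<=` N.
  have [hc gc hg gh hp] := hgP q.
  rewrite -{1}hp => /Bpi'[i iN]; exists i => y /iN.
  by rewrite /= gh.
have [c cinj] := wtree_power_inj Tinf.
have /choice[tau tauP] (qi : X * T) : exists t, B qi.1 qi.2 (weval p B t).
  by have [Bo B0] := Bne qi.1 qi.2; exact: weval_dense.
have [|pr _ prinj] := card_le_ex (card_sqT Tinf).
  by have [a _] := infinite_setN0 Tinf; exists (a, a).
(* The pairing [pr] merges |T| many subsets of [T] into a single one. *)
pose code q := pr @` [set z | c (tau (q, z.1)) z.2].
apply: (card_le_fun (f := code)) => // q q' _ _ e.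
have {}e i : tau (q, i) = tau (q', i).
  apply: cinj; have {}e := image_injective (fun x y => prinj x y I I) e.
  apply/seteqP; split=> z.
    by move=> cz; have : [set z | c (tau (q, z.1)) z.2] (i, z) by []; rewrite e.
  by move=> cz; have : [set z | c (tau (q', z.1)) z.2] (i, z) by []; rewrite -e.
apply: contrapT => /(hausdorff_open_sep Xc)[U [V [Uo Vo Uq Vq UV]]].
have [hc gc hg gh hp] := hgP q; have [hc' gc' hg' gh' hp'] := hgP q'.
have nU : nbhs p (h q @^-1` U) by apply: hc; rewrite hp; apply: open_nbhs_nbhs.
have nV : nbhs p (h q' @^-1` V) by apply: hc'; rewrite hp'; apply: open_nbhs_nbhs.
have [A] := Ppi _ (filterI nU nV); rewrite bE => -[i _ <-] iP.
have y1 := tauP (q, i); have y2 := tauP (q', i); rewrite -e /= in y1 y2.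
have : (U `&` V) (weval p B (tau (q, i))).
  split.
    by have [+ _] := iP _ y1; rewrite /= gh.
  by have [_] := iP _ y2; rewrite /= gh'.
by rewrite UV.
Qed.

(** If [K] embeds in the power set, its image there is an intermediate family to which [GCH]
    applies. *)
Lemma GCH_power_le (T K : Type) : GCH -> infinite_set [set: T] ->
  [set: T] #<= [set: K] -> ~ ([set: K] #<= [set: T]) -> [set: set T] #<= [set: K].
Proof.
move=> gch Tinf TK nKT; have [//|KP] := card_total [set: set T] [set: K].
have [K0|/set0P Kn0] := eqVneq [set: K] set0.
  by case: nKT; rewrite K0; exact: card_ge0.
have [f _ finj] := card_le_ex KP Kn0.
have fK : range f #= [set: K] by apply: inj_card_eq => x y _ _ /finj; apply.
move: fK; rewrite card_eq_le => /andP[fK1 fK2].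
have [h|h] := gch T (range f) Tinf (card_le_trans TK fK2).
  by case: nKT; exact: card_le_trans fK2 h.
exact: card_le_trans h fK1.
Qed.

(** * Neighbourhood families of large pi-character *)

(** An omega^op-like family of neighbourhoods, counted by indices: any one set is repeated only
    finitely often. *)
Definition flat (X : topologicalType) (q : X) T (A : set T) :=
  exists N : T -> set X, (forall k, A k -> nbhs q (N k)) /\
    forall O, nbhs q O -> finite_set [set k | A k /\ O `<=` N k].

Lemma flat_homogeneous (X : topologicalType) (q q' : X) T (A : set T) :
  homogeneous X -> flat q A -> flat q' A.
Proof.
move=> Xh [N [Nn Nf]]; have [f [[g [fc gc fg gf]] fq]] := Xh q q'.
exists (fun k => g @^-1` N k); split=> [k /Nn|O nO].
  by rewrite -[q in nbhs q _]fg fq => /gc.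
have nfO : nbhs q (f @^-1` O) by apply: fc; rewrite fq.
apply: sub_finite_set (Nf _ nfO) => k [Ak ON]; split=> // y /ON.
by rewrite /= fg.
Qed.

Lemma flat_card_le (X : topologicalType) (q : X) T U (A : set T) (B : set U) :
  A #<= B -> flat q B -> flat q A.
Proof.
move=> AB [N [Nn Nf]]; have [A0|/set0P An0] := eqVneq A set0.
  exists (fun=> setT); split=> [k|O _]; first by rewrite A0.
  by apply: sub_finite_set (finite_set0 T) => k []; rewrite A0.
have [f fA finj] := card_le_ex AB An0.
exists (fun k => N (f k)); split=> [k /fA/Nn//|O nO].
apply: card_le_finite (Nf _ nO).
apply: (card_le_fun (f := f)) => [x [/fA ? ?]//|x y [Ax _] [Ay _]]; exact: finj.
Qed.

Lemma io_weak_seg (K : eqType) U (lt : K -> K -> Prop) (Q : set U) x :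
  initial_order lt -> infinite_set Q -> [set y | lt y x] #<= Q ->
  [set y | ~ lt x y] #<= Q.
Proof.
move=> io Qinf sQ; apply: (card_le_trans (subset_card_le (B := [set y | lt y x] `|` [set x]) _)).
  by move=> y /= nxy; have [?|->|//] := io_total io y x; [left|right].
apply: card_leU => //.
by apply: card_le_trans (finite_set_countable (finite_set1 x)) _; apply/infiniteP.
Qed.

(** * Independent families of pairs of open sets *)

Section Independence.
Variables (X : topologicalType) (K : choiceType) (lt : K -> K -> Prop).
Hypotheses (Xc : compactum X) (io : initial_order lt).

Definition below (x : K) := [set s : seq (K * bool) | {in s, forall z, lt z.1 x}].

Definition side (f : K -> set X * set X * seq (K * bool)) (z : K * bool) : set X :=
  if z.2 then (f z.1).1.1 else (f z.1).1.2.

Definition box f (s : seq (K * bool)) := [set y | {in s, forall z, side f z y}].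

(** Recursion along [lt] needs boxes to depend only on the pairs they mention. A box may be empty,
    for instance by taking both sides of one pair, so nonemptiness is assumed wherever it
    matters. *)
Lemma box_ext f g s : {in s, forall z, f z.1 = g z.1} -> box f s = box g s.
Proof.
by move=> fg; apply/seteqP; split=> y h z zs; have := h z zs; rewrite /side fg.
Qed.

(* [t] is a pair of open sets together with a finite box [t.2] below which both
   open sets are independent of all earlier pairs. *)
Definition stage (k : K) f (t : set X * set X * seq (K * bool)) :=
  [/\ open t.1.1 /\ open t.1.2, closure t.1.1 `&` closure t.1.2 = set0,
      below k t.2, box f t.2 !=set0 &
      forall c, below k c -> box f (c ++ t.2) !=set0 ->
        box f (c ++ t.2) `&` t.1.1 !=set0 /\ box f (c ++ t.2) `&` t.1.2 !=set0].

Lemma stage_ext k f g t : (forall j, lt j k -> f j = g j) -> stage k f t -> stage k g t.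
Proof.
move=> fg [op cl bt b0 h]; split => //; first by rewrite -(@box_ext f) // => z /bt /fg.
move=> c ck; have e : {in c ++ t.2, forall z, f z.1 = g z.1}.
  by move=> z; rewrite mem_cat => /orP[/ck|/bt] /fg.
by rewrite -(box_ext e); exact: h.
Qed.

(** There are too few boxes for a pi-base at any point, so each [q] has a pair whose second set
    meets all nonempty boxes. Finitely many first sets cover the space; if each could be avoided by
    refining boxes, successive refinement would give a nonempty box outside the cover. *)
Lemma stage_ex (x0 : X) k f :
  (forall (q : X) P, local_pibase q P -> ~ (P #<= below k)) ->
  (forall j, lt j k -> stage j f (f j)) -> exists t, stage k f t.
Proof.
move=> nP fS.
have box_open s : below k s -> open (box f s).
  move=> sk; apply: open_seqI => z /sk /fS [] [Vo Wo] _ _ _ _.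
  by rewrite /side; case: z.2.
have /choice[vw vwP] q : exists vw : set X * set X, [/\ open vw.1, open vw.2, vw.1 q,
    closure vw.1 `&` closure vw.2 = set0 &
    forall s, below k s -> box f s !=set0 -> box f s `&` vw.2 !=set0].
  have [N nN NP] : exists2 N, nbhs q N &
      forall s, below k s -> box f s !=set0 -> ~ (box f s `<=` N).
    apply: contrapT => noN.
    apply: (nP q (box f @` [set s | below k s /\ box f s !=set0])).
      split=> [_ [s [sk s0] <-]|N nN]; first by split => //; exact: box_open.
      apply: contrapT => noU; apply: noN; exists N => // s sk s0 sN; apply: noU.
      by exists (box f s) => //; exists s.
    by apply: card_le_trans (card_image_le _ _) (subset_card_le _) => s [].
  have [U [Uo Uq UN]] := regular_nbhs Xc nN.
  have [V [Vo Vq VU]] := regular_nbhs Xc (open_nbhs_nbhs (conj Uo Uq)).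
  (* No nonempty box lies in [N], hence none lies in the closure of [U]. *)
  exists (V, ~` closure U); split => //=.
  - exact/closed_openC/closed_closure.
  - apply/seteqP; split=> y // [/VU Uy /(_ _ (open_nbhs_nbhs (conj Uo Uy)))].
    by move=> [z [nUz Uz]]; apply: nUz; exact: subset_closure.
  - move=> s sk /(NP s sk) /existsNP[y /not_implyP[sy nNy]].
    by exists y; split => // /UN.
have [||l lP] := @compact_subcover X Xc X (fun q => (vw q).1).
- by move=> q; have [] := vwP q.
- by move=> q; exists q; have [] := vwP q.
have [q [b [bk b0 bP]]] : exists q b, [/\ below k b, box f b !=set0 &
    forall c, below k c -> box f (c ++ b) !=set0 -> box f (c ++ b) `&` (vw q).1 !=set0].
  apply: contrapT => noq.
  have [b [bk [y yb] bl]] : exists b, [/\ below k b, box f b !=set0 &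
      {in l, forall q, box f b `&` (vw q).1 = set0}].
    elim: l {lP} => [|q l [b [bk b0 bl]]]; first by exists [::]; split => //; exists x0.
    have : ~ (forall c, below k c -> box f (c ++ b) !=set0 ->
        box f (c ++ b) `&` (vw q).1 !=set0) by move=> h; apply: noq; exists q, b.
    move=> /existsNP[c /not_implyP[ck /not_implyP[c0 cq]]]; exists (c ++ b); split => //.
      by move=> z; rewrite mem_cat => /orP[/ck|/bk].
    move=> r; rewrite inE => /orP[/eqP->|rl]; first by apply: contrapT => /eqP/set0P.
    apply/seteqP; split=> y // [yb vy]; rewrite -(bl r rl).
    by split => // z zb; apply: yb; rewrite mem_cat zb orbT.
  by have [q ql vy] := lP y; have : (box f b `&` (vw q).1) y by []; rewrite (bl q ql).
have [Vo Wo _ cl WP] := vwP q; exists ((vw q).1, (vw q).2, b); split => //= c ck c0.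
split; first exact: bP.
by apply: WP => // z; rewrite mem_cat => /orP[/ck|/bk].
Qed.

(** [D] stands for a regular uncountable cardinal: [Dbelow] and [Dnat] express that short families
    are bounded. It is later all of [K], or a segment whose type is a successor cardinal. *)
Variable D : set K.
Hypothesis Ddown : forall x y, D x -> lt y x -> D y.
Hypothesis Dpi : forall x (q : X) P, D x -> local_pibase q P -> ~ (P #<= below x).
Hypothesis Dbelow : forall x (g : seq (K * bool) -> K), D x -> (forall s, D (g s)) ->
  exists2 y, D y & forall s, below x s -> lt (g s) y.
Hypothesis Dnat : forall g : nat -> K, (forall n, D (g n)) ->
  exists2 y, D y & forall n, lt (g n) y.

(* A Fodor-style argument: if every fibre of [b] were bounded by some [g s], a
   point [d] closed under [g] of cofinality omega would lie below [g (b d)],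
   although [b d] is already a finite sequence below some earlier closure
   point. *)
Lemma pressing_down (b : K -> seq (K * bool)) : D !=set0 ->
  (forall k, D k -> below k (b k)) ->
  exists s, forall y, D y -> exists k, [/\ D k, ~ lt k y & b k = s].
Proof.
move=> [x0 Dx0] bk; apply: contrapT => /forallNP nos.
have /choice[g gP] s : exists y, D y /\ forall k, D k -> b k = s -> lt k y.
  have /existsNP[y /not_implyP[Dy /forallNP h]] := nos s.
  exists y; split=> // k Dk bs; apply: contrapT => ky; apply: (h k).
  by split.
have /choice[r rP] x : exists y, D x -> [/\ D y, lt x y & forall s, below x s -> lt (g s) y].
  have [Dx|nDx] := pselect (D x); last by exists x.
  have [y Dy yP] := Dbelow Dx (fun s => (gP s).1).
  (* The sequence [x], [y], [y], ... turns [Dnat] into a strict bound for two elements. *)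
  have [|z Dz zP] := @Dnat (fun n => if n is 0 then x else y); first by case.
  exists z => _; split=> // [|s /yP h]; first exact: (zP 0).
  exact: (io_trans io h (zP 1)).
pose d n := iter n r x0.
have Dd n : D (d n) by elim: n => [//|n IH]; have [] := rP _ IH.
have dS n : lt (d n) (d n.+1) by have [] := rP _ (Dd n).
have dmono m n : (m < n)%N -> lt (d m) (d n).
  elim: n => // n IH; rewrite ltnS leq_eqVlt => /orP[/eqP->//|/IH h].
  exact: io_trans io _ _ _ h (dS n).
have [|z0 Dz0 z0P] := Dnat (g := d); first exact: Dd.
(* The least strict bound [z] of the sequence is its supremum, so a finite list below [z] is already
   below some [d N]. *)
have [|z [Dz zP] zmin] := @io_min _ _ [set z | D z /\ forall n, lt (d n) z] io.
  by exists z0.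
have [N NP] : exists N, below (d N) (b z).
  have : below z (b z) by exact: bk.
  elim: (b z) => [_|a s IH sz]; first by exists 0.
  have [|N NP] := IH; first by move=> w ws; apply: sz; rewrite inE ws orbT.
  have az : lt a.1 z by apply: sz; rewrite mem_head.
  have [M aM] : exists M, lt a.1 (d M).
    have /not_andP[] := zmin _ az; first by move=> []; exact: Ddown az.
    move=> /existsNP[n na]; have [?|->|//] := io_total io a.1 (d n); first by exists n.
    by exists n.+1.
  have le n m : (n <= m)%N -> forall w, lt w (d n) -> lt w (d m).
    rewrite leq_eqVlt => /orP[/eqP->//|nm w wn]; exact: io_trans io _ _ _ wn (dmono _ _ nm).
  exists (maxn M N) => w; rewrite inE => /orP[/eqP->|/NP].
    by apply: le aM; exact: leq_maxl.
  by apply: le; exact: leq_maxr.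
have [_ _ /(_ _ NP) gN] := rP _ (Dd N).
have gz := io_trans io gN (zP N.+1).
exact: (io_asym io gz ((gP (b z)).2 _ Dz erefl)).
Qed.

(** Build stages along [D], then press down to an unbounded set of indices sharing one box [s].
    Inside [s] these pairs are independent: the largest index can always be added to a nonempty box
    of smaller ones. *)
Lemma independent_pairs : D !=set0 -> [set: X] !=set0 ->
  exists (S : set K) (V W : K -> set X), [/\ S `<=` D,
    forall y, D y -> exists2 k, S k & ~ lt k y,
    forall k, S k -> closure (V k) `&` closure (W k) = set0 &
    forall (l : seq K) (eps : K -> bool), {in l, forall k, S k} ->
      exists y, {in l, forall k, (if eps k then V k else W k) y}].
Proof.
move=> D0 [x0 _].
have [f fP] : exists f, forall k, D k -> stage k f (f k).
  apply: (@wf_choice _ _ lt (set0, set0, [::]) (fun k f t => D k -> stage k f t)).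
  - exact: io_wf.
  - by move=> x f g t fg h Dx; apply: stage_ext (h Dx).
  move=> k f fst; have [Dk|nDk] := pselect (D k); last by exists (set0, set0, [::]).
  have [||t tP] := @stage_ex x0 k f; last by exists t.
    by move=> q P qP; exact: Dpi Dk qP.
  by move=> j jk; apply: fst => //; exact: Ddown jk.
have [|s sP] := @pressing_down (fun k => (f k).2) D0.
  by move=> k /fP[].
exists [set k | D k /\ (f k).2 = s], (fun k => (f k).1.1), (fun k => (f k).1.2).
split.
- by move=> k [].
- by move=> y /sP[k [Dk ky ks]]; exists k.
- by move=> k [/fP[]].
move=> l eps lS; suff [y yP] : box f ([seq (k, eps k) | k <- l] ++ s) !=set0.
  exists y => k kl; have := yP (k, eps k); rewrite /side /=; apply.
  by rewrite mem_cat map_f.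
move: {2}(size l) (leqnn (size l)) => n.
elim: n l lS => [|n IH] l lS.
  rewrite leqn0 => /nilP ->; have [d Dd] := D0; have [k [Dk _ <-]] := sP d Dd.
  by have [] := fP k Dk.
have [->|/(io_seq_max io)[m ml mP]] := eqVneq l [::].
  by move=> _; apply: (IH [::]).
(* Lists may repeat, so all copies of the largest index are removed; the induction is on a bound for
   the length. *)
move=> sz; pose l' := [seq j <- l | j != m].
have [||y yP] := IH l'.
- by move=> j; rewrite mem_filter => /andP[_ /lS].
- rewrite -ltnS; apply: leq_trans sz; rewrite size_filter -(count_predC (pred1 m) l).
  by rewrite -addn1 addnC leq_add2r // -has_count; apply/hasP; exists m => /=.
have [Dm ms] := lS m ml; have [_ _ _ _] := fP m Dm; rewrite ms.
move=> /(_ [seq (k, eps k) | k <- l'])[||h1 h2]; last 1 first.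
- have [z [zb zm]] : box f ([seq (k, eps k) | k <- l'] ++ s) `&` side f (m, eps m) !=set0.
    by rewrite /side /=; case: (eps m).
  exists z => w; rewrite mem_cat => /orP[/mapP[j jl ->]|ws].
    have [->//|jm] := eqVneq j m; apply: zb.
    by rewrite mem_cat map_f // mem_filter jm.
  by apply: zb; rewrite mem_cat ws orbT.
- move=> w /mapP[j]; rewrite mem_filter => /andP[/eqP jm /mP[//|?]] ->.
  by [].
- by exists y.
Qed.

(* The complement of [O] is a closed set on which the map to the cube given by [C]
   is irreducible. *)
Lemma independent_maximal_open (S : set K) (C : K -> bool -> set X) :
  (forall k b, closed (C k b)) ->
  (forall (l : seq K) (eps : K -> bool), {in l, forall k, S k} ->
    exists y, {in l, forall k, C k (eps k) y}) ->
  exists O : set X, [/\ open O,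
    forall (l : seq K) eps, {in l, forall k, S k} -> exists2 y, ~ O y & {in l, forall k, C k (eps k) y} &
    forall O', open O' -> O `<` O' -> exists (l : seq K) eps, {in l, forall k, S k} /\
      forall y, {in l, forall k, C k (eps k) y} -> O' y].
Proof.
move=> Ccl Cind; pose P := [set O : set X | open O /\ forall (l : seq K) eps,
  {in l, forall k, S k} -> exists2 y, ~ O y & {in l, forall k, C k (eps k) y}].
have P0 : P set0.
  split=> [|l eps /Cind-/(_ eps)[y yP]]; [exact: open0|by exists y].
have [] := @Zorn_bigcup _ P; last first.
  move=> O [[Oo OP] Omax]; exists O; split => // O' O'o OO'.
  apply: contrapT => noL; apply: (Omax O' OO'); split => // l eps lS.
  apply: contrapT => noy; apply: noL; exists l, eps; split => // y yl.
  by apply: contrapT => nO'; apply: noy; exists y.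
move=> F FP Ftot; split.
  by apply: bigcup_open => O /FP[].
move=> l eps lS.
pose c := [set y | {in l, forall k, C k (eps k) y}].
have ccl : closed c.
  rewrite (_ : c = \bigcap_(k in [set` l]) C k (eps k)).
    by apply: closed_bigI => k _; exact: Ccl.
  by apply/seteqP; split.
(* Sets outside the chain are sent to [c], so the common point lies in [c] even when the chain is
   empty. *)
pose g (G : set X) := if pselect (F G) then ~` G `&` c else c.
have [||y yP] := @compact_centered X Xc _ g.
- move=> G; rewrite /g; case: pselect => [Fo|?] //; have [oo _] := FP G Fo.
  by apply: closedI => //; exact: open_closedC.
- move=> s; have [G Po oP] : exists2 G, (F G \/ G = set0) & {in s, forall G', F G' -> G' `<=` G}.
    elim: s => [|a s [G Fo oP]]; first by exists set0 => //; right.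
    have [Fa|nFa] := pselect (F a); last first.
      by exists G => // G'; rewrite inE => /orP[/eqP->//|/oP].
    have [ao|oa] : a `<=` G \/ G `<=` a.
      by case: Fo => [Fo|->]; [exact: Ftot|right].
      by exists G => // G'; rewrite inE => /orP[/eqP->//|/oP].
    exists a; first by left.
    move=> G'; rewrite inE => /orP[/eqP-> _|/oP h /h h']; [exact: subset_refl|exact: subset_trans h' oa].
  have [_ /(_ _ eps lS)[y ny yl]] : P G by case: Po => [/FP//|->].
  exists y => G' G's; rewrite /g; case: pselect => // FG'; split => //.
  by apply: contra_not ny; exact: oP.
exists y => [[G Fo oy]|].
  by have := yP G; rewrite /g; case: pselect => // _ [].
by have := yP set0; rewrite /g; case: pselect => // _ [].
Qed.

(** Choose [q] outside the maximal [O] and in every [closure (V k)]. For a neighbourhood [U],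
    maximality puts a finite box on [l] inside the union of [O] and the interior of [U]. For [k] not
    in [l], that box has a point outside [O] in [closure (W k)]; it lies in [U], so [U] is not
    contained in the complement of [closure (W k)]. *)
Lemma flat_ex : [set: X] !=set0 -> exists q : X, flat q D.
Proof.
move=> X0; have [D0|/set0P D0] := eqVneq D set0.
  have [q _] := X0; exists q; exists (fun=> setT); split=> [k|O _].
    by rewrite D0.
  by apply: sub_finite_set (finite_set0 K) => k []; rewrite D0.
have [S [V [W [SD Sunb VW ind]]]] := independent_pairs D0 X0.
have DS : D #<= S.
  have [d0 _] := D0.
  have [phi phiP] : exists phi : K -> K, forall k, D k ->
      S (phi k) /\ forall j, lt j k -> lt (phi j) (phi k).
    apply: (@wf_choice _ _ lt d0 (fun k f t => D k ->
      S t /\ forall j, lt j k -> lt (f j) t)).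
    - exact: io_wf.
    - by move=> x f g t fg h /h[St ht]; split => // j jx; rewrite -fg //; exact: ht.
    move=> k f fP; have [Dk|nDk] := pselect (D k); last by exists d0.
    have fD j : lt j k -> D (f j).
      by move=> jk; apply: SD; have [] := fP j jk (Ddown Dk jk).
    (* [Dbelow] bounds families indexed by finite lists; an index [j] below [k] is passed as a
       one-element list, and other lists get default values. *)
    have [|y Dy yP] := Dbelow (g := fun s => if s is z :: _ then
        (if pselect (lt z.1 k) then f z.1 else k) else k) Dk.
      by case=> [//|z _]; case: pselect => [zk|?] //; exact: fD.
    have [t St ty] := Sunb y Dy; exists t => _; split => // j jk.
    have := yP [:: (j, true)]; rewrite /=; case: pselect => [?|//] fjy.
    have {}fjy : lt (f j) y by apply: fjy => z; rewrite inE => /eqP->.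
    have [?|<-//|] := io_total io y t; last by move=> /ty.
    exact: (io_trans io fjy).
  apply: (card_le_fun (f := phi)) => [x /phiP[]//|x y Dx Dy e].
  have [xy|//|yx] := io_total io x y.
    by have [_ /(_ _ xy)] := phiP y Dy; rewrite e => /(io_irr io).
  by have [_ /(_ _ yx)] := phiP x Dx; rewrite e => /(io_irr io).
pose C k (b : bool) := closure (if b then V k else W k).
have [||O [Oo OP Omax]] := @independent_maximal_open S C.
- by move=> k b; exact: closed_closure.
- move=> l eps /ind-/(_ eps)[y yP]; exists y => k kl.
  exact/subset_closure/yP.
pose g (o : option K) := if o is Some k then
  (if pselect (S k) then closure (V k) else setT) else ~` O.
have [||q qP] := @compact_centered X Xc _ g.
- move=> [k|] /=; last exact: open_closedC.
  by case: pselect => ?; [exact: closed_closure|exact: closedT].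
- move=> s; pose l := [seq k <- pmap id s | `[< S k >]].
  have [|y nOy yl] := OP l (fun=> true).
    by move=> k; rewrite mem_filter => /andP[/asboolP].
  exists y => -[k|] ks //=; case: pselect => // Sk; apply: (yl k).
  by rewrite mem_filter mem_pmap; apply/andP; split; [exact/asboolP|apply/mapP; exists (Some k)].
exists q; apply: flat_card_le DS _; exists (fun k => ~` closure (W k)); split.
  move=> k Sk; apply: open_nbhs_nbhs; split; first exact/closed_openC/closed_closure.
  move=> Wq; have Vq : closure (V k) q by have := qP (Some k); rewrite /=; case: pselect.
  by have : (closure (V k) `&` closure (W k)) q by []; rewrite VW.
move=> U nU; apply: contrapT => Zinf.
have [||l [eps [lS lU]]] := Omax (O `|` U°).
- by apply: openU => //; exact: open_interior.
- split; first exact: subsetUl.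
  by move=> /(_ q) h; apply: (qP None); apply: h; right.
have [k [[Sk UW] kl]] : exists k, (S k /\ U `<=` ~` closure (W k)) /\ k \notin l.
  apply: contrapT => nok; apply: Zinf; apply: sub_finite_set (finite_seq l) => k Zk /=.
  by apply: contrapT => /negP kl; apply: nok; exists k.
have [|y nOy yl] := OP (k :: l) (fun j => if j == k then false else eps j).
  by move=> j; rewrite inE => /orP[/eqP->//|/lS].
have : (O `|` U°) y.
  apply: lU => j jl; have := yl j; rewrite inE jl orbT => /(_ isT).
  by case: eqVneq => // jk; rewrite -jk jl in kl.
case=> // /interior_subset /UW; apply.
by have := yl k; rewrite inE eqxx; apply.
Qed.

End Independence.

Lemma card_below_le (K : choiceType) U (lt : K -> K -> Prop) (Q : set U) x :
  infinite_set Q -> [set y | lt y x] #<= Q -> below lt x #<= Q.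
Proof.
move=> Qinf sQ; apply: card_le_seq => //.
apply: (card_le_trans _ (card_leX (B := [set: bool]) Qinf sQ _)).
  by apply: subset_card_le => -[y b] /= yx.
exact: card_le_trans (countableP _) ((infiniteP Q).1 Qinf).
Qed.

(** * Flat families of the size of the character *)

Section FlatAtCharacter.
Variables (X : topologicalType) (K : choiceType) (lt : K -> K -> Prop) (L : set K) (q : X).
Hypotheses (Xc : compactum X) (Xh : homogeneous X) (io : initial_order lt).
Hypotheses (Linf : infinite_set L) (LK : ~ ([set: K] #<= L)).
Hypothesis pi : forall (q : X) P, local_pibase q P -> [set: K] #<= P.

Lemma flat_regular :
  (forall S : set K, ~ ([set: K] #<= S) -> exists y, forall s, S s -> lt s y) ->
  flat q [set: K].
Proof.
move=> reg; have X0 : [set: X] !=set0 by exists q.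
have small x : ~ ([set: K] #<= below lt x).
  move=> le; have [Q [Qinf sQ _ nKQ]] := card_small_cover Linf LK (@io_seg _ _ x io).
  by apply: nKQ; apply: card_le_trans le _; exact: card_below_le.
have [||||q' fl] := @flat_ex X K lt Xc io setT _ _ _ _ X0.
- by [].
- by move=> x q' P _ /pi KP PB; apply: (small x); exact: card_le_trans PB.
- move=> x g _ _; have [|y yP] := reg (g @` below lt x).
    by move=> le; apply: (small x); apply: card_le_trans le (card_image_le _ _).
  by exists y => // s sx; apply: yP; exists s.
- move=> g _; have [|y yP] := reg (range g).
    move=> le; apply: LK; apply: card_le_trans le _.
    by apply: card_le_trans (card_image_le _ _) _; apply/infiniteP.
  by exists y => // n; apply: yP; exists n.
exact: flat_homogeneous fl.
Qed.

(** For the least such [z] the segment has the type of the successor of |A|, which is regular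
    because a union of |A| sets of size at most |A| has size at most |A|. *)
Lemma flat_successor (A : set K) z : infinite_set A -> ~ ([set: K] #<= A) ->
  ~ ([set y | lt y z] #<= A) -> flat q A.
Proof.
move=> Ainf nKA nzA; have X0 : [set: X] !=set0 by exists q.
have [|{nzA}z nzA zmin] := @io_min _ _ [set z | ~ ([set y | lt y z] #<= A)] io.
  by exists z.
have seg x : lt x z -> [set y | lt y x] #<= A by move=> /zmin /contrapT.
have bnd I (E : set I) (g : I -> K) : E #<= A -> (forall i, lt (g i) z) ->
    exists2 y, lt y z & forall i, E i -> lt (g i) y.
  move=> EA gz; apply: contrapT => noy; apply: nzA.
  apply: (card_le_trans (subset_card_le (B := \bigcup_(i in E) [set y | ~ lt (g i) y]) _)).
    move=> y /= yz; apply: contrapT => ny; apply: noy; exists y => // i Ei.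
    by apply: contrapT => gy; apply: ny; exists i.
  apply: card_le_bigcup => // i _; apply: io_weak_seg => //; exact: seg.
have [||||q' fl] := @flat_ex X K lt Xc io [set y | lt y z] _ _ _ _ X0.
- by move=> x y /= xz yx; exact: io_trans io _ _ _ yx xz.
- move=> x q' P xz /pi KP PB; apply: nKA; apply: card_le_trans KP _.
  by apply: card_le_trans PB _; apply: card_below_le => //; exact: seg.
- by move=> x g xz gz; apply: bnd => //; apply: card_below_le => //; exact: seg.
- move=> g gz; have [|y yz yP] := bnd _ setT g _ gz; first exact/infiniteP.
  by exists y => // n; apply: yP.
by apply: flat_card_le (flat_homogeneous q Xh fl); exact: card_nle.
Qed.

(** Each [k] is assigned some [i k] in the cofinal set [S] with [k] at most [i k]. Intersecting with
    a flat family [T] on [S] leaves finitely many values of [i k] for a given [O], and the family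
    for each of them leaves finitely many [k]. *)
Lemma flat_singular (S : set K) : ~ ([set: K] #<= S) ->
  (forall y, exists2 s, S s & ~ lt s y) -> flat q [set: K].
Proof.
move=> nKS Sunb.
have fl (A : set K) : ~ ([set: K] #<= A) -> flat q A.
  move=> nKA; have [Q1 [Q1inf AQ1 _ nKQ1]] := card_small_cover Linf LK nKA.
  have [Q [Qinf SQ QQ nKQ]] := card_small_cover Q1inf nKQ1 nKS.
  apply: (flat_card_le (card_le_trans AQ1 QQ)).
  (* If every segment had size at most |Q|, the segments up to members of [S] would cover [K] by |Q|
     many sets of that size. *)
  have [z nzQ] : exists z, ~ ([set y | lt y z] #<= Q).
    apply: contrapT => /forallNP allz; apply: nKQ.
    apply: (card_le_trans (subset_card_le (B := \bigcup_(i in S) [set y | ~ lt i y]) _)).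
      by move=> y _; have [s Ss sy] := Sunb y; exists s.
    by apply: card_le_bigcup => // i _; apply: io_weak_seg => //; apply: contrapT; exact: allz.
  exact: flat_successor nzQ.
have [T [Tn Tf]] := fl _ nKS.
have /choice[N NP] i := fl _ (@io_small _ _ io i).
have /choice[i iP] k : exists i, S i /\ ~ lt i k by have [i] := Sunb k; exists i.
exists (fun k => N (i k) k `&` T (i k)); split=> [k _|O nO].
  have [Si ik] := iP k; apply: filterI; last exact: Tn.
  by have [h _] := NP (i k); exact: h.
apply: sub_finite_set (bigcup_finite (Tf _ nO) (F := fun i => [set k | ~ lt i k /\ O `<=` N i k]) _).
  move=> k [_ Ok]; have [Si ik] := iP k; exists (i k).
    by split => // y /Ok[].
  by split => // y /Ok[].
by move=> j _; have [_] := NP j; exact.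
Qed.

Lemma flat_character : flat q [set: K].
Proof.
have [reg|/existsNP[S /not_implyP[nKS nb]]] := pselect (forall S : set K,
   ~ ([set: K] #<= S) -> exists y, forall s, S s -> lt s y).
  exact: flat_regular.
apply: (flat_singular nKS) => y; apply: contrapT => nos; apply: nb; exists y => s Ss.
by apply: contrapT => sy; apply: nos; exists s.
Qed.

End FlatAtCharacter.

Lemma flat_chiNt (X : topologicalType) (p : X) (K : Type) (e : K -> set X) :
  local_base p (range e) -> flat p [set: K] -> chiNt_le_cellularity_at p.
Proof.
move=> [eo eb] [N [Nn Nf]].
exists (range (fun k => (N k)° `&` e k)); split; first split.
- move=> _ [k _ <-]; have [ko kp] : open (e k) /\ e k p by apply: eo; exists k.
  by split; [apply: openI => //; exact: open_interior|split => //; exact: Nn].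
- move=> M /eb[_ [k _ <-] kM]; exists ((N k)° `&` e k); first by exists k.
  by move=> y [_ /kM].
move=> _ [k _ <-]; left.
have [ko kp] : open (e k) /\ e k p by apply: eo; exists k.
have nU : nbhs p ((N k)° `&` e k).
  by apply: open_nbhs_nbhs; split; [apply: openI => //; exact: open_interior|split => //; exact: Nn].
apply: sub_finite_set (finite_image (fun k => (N k)° `&` e k) (Nf _ nU)).
move=> _ [[j _ <-] sub]; exists j => //; split => // y /sub[/interior_subset//].
Qed.

Lemma local_base_homogeneous (X : topologicalType) (p q : X) (B : set (set X)) :
  homogeneous X -> local_base q B -> exists2 B', local_base p B' & B' #<= B.
Proof.
move=> Xh [Bo Bb]; have [f [[g [fc gc fg gf]] fp]] := Xh p q.
exists [set f @^-1` U | U in B]; last exact: card_image_le.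
split=> [_ [U BU <-]|N nN].
  have [Uo Uq] := Bo U BU; split; last by rewrite /= fp.
  by apply: open_comp => // y _; exact: fc.
have /Bb[U BU UN] : nbhs q (g @^-1` N).
  by apply: gc; rewrite -fp fg.
by exists (f @^-1` U); [exists U|move=> y /UN; rewrite /= fg].
Qed.

Theorem theorem1p7 (X : topologicalType) :
  GCH -> compactum X -> homogeneous X -> chiNt_le_cellularity X.
Proof.
move=> gch Xc Xh p.
have lb0 : local_base p [set U | open U /\ U p].
  split=> // N nN; exists N°; last exact: interior_subset.
  by split; [exact: open_interior|exact: nN].
have [[B0 lbB0] B0min] := card_min (fun B : {B | local_base p B} => sval B) (exist _ _ lb0).
have {}B0min B : local_base p B -> B0 #<= B by move=> lb; exact: (B0min (exist _ B lb)).
have [B0fin|B0inf] := pselect (finite_set B0).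
  exists B0; split => // U BU; left; apply: sub_finite_set B0fin => V; by case.
pose K : choiceType := B0; pose e : K -> set X := set_val.
have KB0 : [set: K] #= B0 by exact: card_setT.
have eB0 : range e = B0.
  apply/seteqP; split=> [_ [k _ <-]|U BU]; first by rewrite /e set_valE; exact: set_valP.
  by exists (SigSub (mem_set BU)).
have Kinf : infinite_set [set: K].
  by apply: infinite_le B0inf; move: KB0; rewrite card_eq_le => /andP[].
have [lt io] := initial_order_exists Kinf.
have Kmin (q : X) B : local_base q B -> [set: K] #<= B.
  move=> lb; have [B' lb' le] := local_base_homogeneous p Xh lb.
  by rewrite (card_le_eql KB0); apply: card_le_trans le; exact: B0min.
have lbe : local_base p (range e) by rewrite eB0.
(* The first case says that the character is at most c(X). In the second, [L] is a segment smaller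
   than [K] and at least as large as c(X). *)
have [small|/existsNP[x nx]] := pselect (forall x, lt_cellularity X [set y | ~ lt x y]).
  have [U [Ub UP]] := local_base_noncontaining io lbe (Kmin p).
  exists (range U); split => // _ [j _ <-]; apply: lt_cellularity_le (small j).
  apply: card_le_trans (card_image_le U [set y | ~ lt j y]).
  by apply: subset_card_le => _ [[k _ <-] sub]; exists k => //; exact: UP.
have /not_orP[Linf nF] := nx; set L := [set y | ~ lt x y] in Linf nF.
have LK : ~ ([set: K] #<= L) by exact: io_small.
have FL (F : set (set X)) : cellular F -> F #<= L.
  move=> Fc; apply: contrapT => nFL; apply: nF; exists F; split => //; split => //.
  exact: card_nle.
have X0 : [set: X] !=set0 by exists p.
have noQ (q : X) P U (Q : set U) : local_pibase q P -> infinite_set Q -> L #<= Q -> P #<= Q ->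
    [set: K] #<= Q.
  move=> qP Qinf LQ PQ; apply: contrapT => nKQ.
  have /andP[Q1 Q2] : ([set: Q] #<= Q) && (Q #<= [set: Q]) by rewrite -card_eq_le.
  apply: (character_lt_card Xc io Linf LK X0 Kmin).
  have Qinf' := infinite_le Q2 Qinf.
  apply: card_le_trans (homogeneous_card_le Xc Xh Qinf' _ qP (card_le_trans PQ Q2)) _.
    by move=> F /FL h; exact: card_le_trans (card_le_trans h LQ) Q2.
  apply: GCH_power_le => //.
    by apply: card_nle => h; apply: nKQ; exact: card_le_trans h Q1.
  by move=> h; apply: nKQ; exact: card_le_trans h Q1.
(* The larger of [L] and [P] bounds both the cellularity and the pi-base. *)
have pi (q : X) P : local_pibase q P -> [set: K] #<= P.
  move=> qP; have [PL|LP] := card_total P L.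
    by case: LK; exact: (noQ q P _ L).
  by apply: (noQ q P _ P) => //; exact: infinite_le Linf.
exact: flat_chiNt lbe (flat_character p Xc Xh io Linf LK pi).
Qed.
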